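(* Let $q$ be a positive integer and let $X$ be an SRNT graph with parameters $(k,c)$ whose eigenvalue $\lambda_1$ is equal to $q$. Then the number $n$ of vertices of $X$ satisfies $$ \Bigl\lceil 2q^3 + 3q^2 - q +2q(q+1) \sqrt{q^2 +q -2}\, \Bigr\rceil \;\le\; n \;\le\; q^2 (q+3)^2 .$$ Furthermore, the parameter $c$ satisfies $1 \le c \le q(q+1)$, and (i) $c$ is a divisor of $q^4 - q^2$, and (ii) $c + 2q$ is a divisor of $q^4 +3q^3 + 5q^2 +3q + q(q^4 - q^2)/c$.
   Context: An SRNT graph with parameters $(k,c)$, where $k,c$ are integers with $k\ge 3$ and $k>c\ge 1$, is a finite simple non-bipartite connected graph $X$ of diameter $2$ such that: $X$ is regular of degree $k$; any two adjacent vertices have no common neighbours; any two distinct non-adjacent vertices have exactly $c$ common neighbours. The eigenvalues of its adjacency matrix are $k$ (with multiplicity $1$) and the two roots $\lambda_1>0>\lambda_2$ of $\lambda^2+c\lambda-(k-c)=0$, which are integers. *)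

(* Defs.v *)
From HB Require Import structures.
From mathcomp Require Import all_boot all_order all_algebra.
From mathcomp Require Import ring lra.
From mathcomp Require Import reals.

Set Implicit Arguments.
Unset Strict Implicit.
Unset Printing Implicit Defensive.

Import Order.TTheory GRing.Theory Num.Theory.

Local Open Scope ring_scope.

Section Graphs.

(* A finite simple graph is a symmetric irreflexive relation [e] on a finType. *)
Variables (V : finType) (e : rel V).

Definition nbrs (x : V) : {set V} := [set y | e x y].

Definition common_nbrs (x y : V) : {set V} := nbrs x :&: nbrs y.

Definition bipartite : Prop :=
  exists side : V -> bool, forall x y : V, e x y -> side x != side y.

Definition connected_graph : Prop := forall x y : V, connect e x y.

(* Least length of a walk from [x] to [y]. A shortest walk has at most
   [#|V| - 1] edges, so only these lengths are searched; the value [#|V|]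
   means that [y] is not reachable from [x]. *)
Definition gdist (x y : V) : nat :=
  find (fun m => [exists p : m.-tuple V, path e x p && (last x p == y)])
       (iota 0 #|V|).

Definition diameter : nat := \max_(x : V) \max_(y : V) gdist x y.

(* [eigenvalue] uses row eigenvectors; the matrix is symmetric. *)
Definition adjmx (F : nzRingType) : 'M[F]_#|V| :=
  \matrix_(i, j) (e (enum_val i) (enum_val j))%:R.

End Graphs.

Record SRNT (V : finType) (e : rel V) (k c : nat) : Prop := MkSRNT {
  SRNT_sym : symmetric e;
  SRNT_irr : irreflexive e;
  SRNT_k_ge3 : (3 <= k)%N;
  SRNT_c_ltk : (c < k)%N;
  SRNT_c_ge1 : (1 <= c)%N;
  SRNT_nonbip : ~ bipartite e;
  SRNT_conn : connected_graph e;
  SRNT_diam : diameter e = 2%N;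
  SRNT_reg : forall x, #|nbrs e x| = k;
  SRNT_adj : forall x y, e x y -> #|common_nbrs e x y| = 0%N;
  SRNT_nonadj : forall x y, x != y -> ~~ e x y -> #|common_nbrs e x y| = c
}.

(* [x] is the positive one among the two eigenvalues other than [k], which are
   the roots of [X^2 + c X - (k - c)]. For an SRNT graph the conditions are
   redundant: see [SRNT_lambda1_eigen] and [SRNT_lambda1_root]. *)
Definition SRNT_lambda1 (R : realFieldType) (V : finType) (e : rel V)
    (k c : nat) (x : R) : Prop :=
  [/\ eigenvalue (adjmx e R) x,
      x ^+ 2 + c%:R * x - (k%:R - c%:R) = 0
    & 0 < x].

Section Spectrum.

Variables (R : realFieldType) (V : finType) (e : rel V) (k c : nat).
Hypothesis X : SRNT e k c.

Let A := adjmx e R.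
Let J : 'M[R]_#|V| := const_mx 1.

Lemma sum_enum_val (f : V -> bool) :
  \sum_(i < #|V|) (f (enum_val i))%:R = #|[set x | f x]|%:R :> R.
Proof.
pose F x : R := (f x)%:R.
have -> : \sum_(i < #|V|) (f (enum_val i))%:R = \sum_x F x.
  by rewrite [RHS](reindex (@enum_val V V)) //; apply/onW_bij/enum_val_bij.
by rewrite -natr_sum -sum1dep_card [in RHS]big_mkcond.
Qed.

Lemma adjmx_tr : A^T = A.
Proof. by apply/matrixP => i j; rewrite !mxE (SRNT_sym X). Qed.

Lemma adjmx_mulJ : A *m J = k%:R *: J.
Proof.
apply/matrixP => i j; rewrite !mxE mulr1 -(SRNT_reg X (enum_val i)).
by rewrite -sum_enum_val; apply: eq_bigr => l _; rewrite !mxE mulr1.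
Qed.

Lemma J_mul_adjmx : J *m A = k%:R *: J.
Proof.
apply: trmx_inj.
by rewrite trmx_mul linearZ /= trmx_const adjmx_tr adjmx_mulJ.
Qed.

Lemma adjmx_sqr :
  A *m A = (k%:R - c%:R)%:M - c%:R *: A + c%:R *: J.
Proof.
apply/matrixP => i j; rewrite !mxE mulr1.
set x := enum_val i; set y := enum_val j.
have -> : \sum_l A i l * A l j = #|common_nbrs e x y|%:R.
  transitivity (#|[set z | e x z && e y z]|%:R : R).
    rewrite -sum_enum_val; apply: eq_bigr => l _.
    by rewrite !mxE -natrM mulnb (SRNT_sym X _ y).
  by congr (_%:R); apply: eq_card => z; rewrite !inE.
have [eij|neq] := eqVneq i j.
  rewrite /x /y eij /common_nbrs setIid (SRNT_reg X) (SRNT_irr X).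
  by rewrite mulr0 subr0 mulr1n addrNK.
have nxy : x != y by rewrite (inj_eq enum_val_inj).
rewrite mulr0n sub0r; case: (boolP (e x y)) => exy.
  by rewrite (SRNT_adj X exy) mulr1 addNr.
by rewrite (SRNT_nonadj X nxy exy) mulr0 oppr0 add0r.
Qed.

(* There are two distinct non-adjacent vertices. *)
Lemma SRNT_nonadj_pair : exists x y : V, x != y /\ ~~ e x y.
Proof.
have [x _ | V0] := pickP V; last first.
  have := SRNT_diam X; rewrite /diameter big1 // => x.
  by have := V0 x.
have : (1 < #|nbrs e x|)%N by rewrite (SRNT_reg X) (ltn_trans _ (SRNT_k_ge3 X)).
case/card_gt1P => y [z [xy xz nyz]]; exists y, z; split=> //.
apply/negP => eyz; have /eqP := SRNT_adj X eyz.
rewrite cards_eq0 => /eqP/setP/(_ x); rewrite !inE.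
by move: xy xz; rewrite !inE (SRNT_sym X y) (SRNT_sym X z) => -> ->.
Qed.

(* The eigenvalues are [k] and the roots of [X^2 + c X - (k - c)]. *)
Lemma SRNT_eigenvalueE (a : R) :
  eigenvalue A a =
  (a == k%:R) || (a ^+ 2 + c%:R * a - (k%:R - c%:R) == 0).
Proof.
apply/idP/idP => [/eigenvalueP[v vA v0] | /orP[/eqP-> | /eqP root]].
- have [//|ak /=] := eqVneq a k%:R.
  have vJ : v *m J = 0.
    have : v *m A *m J = v *m (A *m J) by rewrite mulmxA.
    rewrite vA adjmx_mulJ -scalemxAl -scalemxAr => /eqP.
    by rewrite -subr_eq0 -scalerBl scaler_eq0 subr_eq0 (negPf ak) => /eqP.
  have : v *m A *m A = v *m (A *m A) by rewrite mulmxA.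
  rewrite adjmx_sqr vA -scalemxAl vA scalerA mulmxDr mulmxBr mul_mx_scalar.
  rewrite -!scalemxAr vJ vA scaler0 addr0 scalerA -scalerBl => /eqP.
  rewrite -subr_eq0 -scalerBl scaler_eq0 (negPf v0) orbF opprB => /eqP <-.
  by apply/eqP; rewrite expr2; ring.
- have [x _] := SRNT_nonadj_pair.
  apply/eigenvalueP; exists (row (enum_rank x) J).
    by rewrite -row_mul J_mul_adjmx linearZ.
  apply/eqP => /rowP/(_ (enum_rank x)); rewrite !mxE => /eqP.
  by rewrite oner_eq0.
have [x [y [nxy exy]]] := SRNT_nonadj_pair.
(* [(A + (c + a)) - c J] times [A - a] vanishes. *)
pose B := A + (c%:R + a)%:M.
pose N : 'M[R]_#|V| := (k%:R - a) *: B - c%:R *: J.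
have BA : B *m A = a *: B + c%:R *: J.
  rewrite mulmxDl adjmx_sqr mul_scalar_mx scalerDr scale_scalar_mx.
  have -> : a * (c%:R + a) = k%:R - c%:R.
    by move: root => /eqP; rewrite subr_eq0 => /eqP <-; ring.
  apply/matrixP => i j; rewrite !mxE; ring.
have NA : N *m A = a *: N.
  rewrite mulmxBl -!scalemxAl BA J_mul_adjmx.
  apply/matrixP => i j; rewrite !mxE; ring.
apply/eigenvalueP; exists (row (enum_rank x) N).
  by rewrite -row_mul NA linearZ.
apply/eqP => /rowP/(_ (enum_rank y)); rewrite !mxE !enum_rankK (negPf exy).
rewrite (inj_eq enum_rank_inj) (negPf nxy) mulr0n addr0 mulr0 mulr1 sub0r.
by move/eqP; rewrite oppr_eq0 pnatr_eq0 (gtn_eqF (SRNT_c_ge1 X)).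
Qed.

Lemma k_not_root :
  k%:R ^+ 2 + c%:R * k%:R - (k%:R - c%:R) != 0 :> R.
Proof.
have k1 : 1 <= k%:R :> R by rewrite ler1n (leq_trans _ (SRNT_k_ge3 X)).
have c1 : 1 <= c%:R :> R by rewrite ler1n (SRNT_c_ge1 X).
by rewrite gt_eqF //; nra.
Qed.

Lemma SRNT_lambda1_eigen (a : R) :
  SRNT_lambda1 e k c a <-> [/\ eigenvalue A a, a != k%:R & 0 < a].
Proof.
split=> [[ea ra a0] | [ea ak a0]]; split=> //.
  by apply: contra_eqN ra => /eqP ->; exact: k_not_root.
by move: ea; rewrite SRNT_eigenvalueE (negPf ak) => /eqP.
Qed.

Lemma SRNT_lambda1_root (a : R) :
  SRNT_lambda1 e k c a <->
  a ^+ 2 + c%:R * a - (k%:R - c%:R) = 0 /\ 0 < a.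
Proof.
split=> [[_ ra a0] // | [ra a0]]; split=> //.
by rewrite SRNT_eigenvalueE ra eqxx orbT.
Qed.

End Spectrum.

(* Main.v *)
Require Import Defs.
From mathcomp Require Import all_boot all_order all_algebra.
From mathcomp Require Import reals.
From mathcomp Require Import zify ring lra.

(** Let A be the adjacency matrix, J the all-ones matrix, q = lambda_1 and
    B = qI - A. The relation A^2 = (k - c)I - cA + cJ and
    k = q^2 + c(q + 1) give B^2 = (2q + c)B + cJ ([shifted_adjmx_sqr]): on
    the vectors with coordinate sum 0, B is 2q + c times an orthogonal
    projection, namely onto the eigenspace of lambda_2 = -(q + c). All the
    claims follow from this and from counting.

    Counting walks of length two ([SRNT_order]) gives
    n = 2q^3 + 3q^2 - q + c(q + 1)(q + 2) + r with c r = q^4 - q^2, hence (i).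
    The product of the last two terms is q^2 (q + 1)^2 (q^2 + q - 2), so the
    lower bound on n is the inequality between the arithmetic and the
    geometric mean.

    The multiplicity m of lambda_2 is the rank, hence the trace, of an
    idempotent, which gives (2q + c) m = q(n - 1) + k ([SRNT_multiplicity]).
    That m is an integer is (ii): the number in (ii) equals
    (c + 2q) ((q + 1)^3 + r - m).

    The bound c <= q(q + 1) is a Krein condition. It is obtained here from a
    single vector of coordinate sum 0 ([SRNT_c_le]), on which the quadratic
    form of B takes the value q^2 (q + 1)(q(q + 1) - c), while B is positive
    semidefinite on such vectors ([sum_shifted_adj_ge0]). Since
    c (q^2 (q + 3)^2 - n) =
    (q(q + 1) - c) ((q + 1)(q + 2) c - q(q - 1)),
    the upper bound on n follows. *)

Set Implicit Arguments.
Unset Strict Implicit.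
Unset Printing Implicit Defensive.

Import Order.TTheory GRing.Theory Num.Theory.

Local Open Scope ring_scope.

(** * Preliminaries on matrices and the number of vertices *)

(** With P = L M a full-rank factorization, P^2 = P cancels to M L = 1, and
    the trace of M L is that of L M. *)
Lemma mxtrace_idempotent (F : fieldType) (n : nat) (P : 'M[F]_n) :
  P *m P = P -> \tr P = (\rank P)%:R.
Proof.
move=> PP.
suff tr_factor (r : nat) (L : 'M[F]_(n, r)) (M : 'M[F]_(r, n)) :
    L *m M = P -> row_full L -> row_free M -> \tr P = r%:R.
  exact: tr_factor (mulmx_base P) (col_base_full P) (row_base_free P).
move=> LM /row_fullP[L' L'L] /row_freeP[M' MM'].
have ML : M *m L = 1%:M.
  have : L' *m (P *m P) *m M' = L' *m P *m M' by rewrite PP.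
  by rewrite -LM !mulmxA L'L mul1mx -!mulmxA MM' mulmx1.
by rewrite -LM mxtrace_mulC ML mxtrace1.
Qed.

Section Spectrum.

Variables (R : realFieldType) (V : finType) (e : rel V) (k c : nat).
Hypothesis X : SRNT e k c.

Let A := adjmx e R.
Let J : 'M[R]_#|V| := const_mx 1.
Let n : R := #|V|%:R.

Lemma constmx1_sqr : J *m J = n *: J.
Proof.
apply/matrixP => i j; rewrite !mxE (eq_bigr (fun=> 1)).
  by rewrite sumr_const card_ord mulr1.
by move=> l _; rewrite !mxE mulr1.
Qed.

Lemma SRNT_card_gt0 : (0 < #|V|)%N.
Proof. by have [x _] := SRNT_nonadj_pair X; apply/card_gt0P; exists x. Qed.

(** The k^2 walks of length two from a vertex, classified by their endpoints:
    compare the entries of (A A) J and A (A J). *)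
Lemma SRNT_order : c%:R * n = k%:R ^+ 2 - k%:R + c%:R + c%:R * k%:R.
Proof.
have i0 := Ordinal SRNT_card_gt0.
have : A *m A *m J = A *m (A *m J) by rewrite mulmxA.
rewrite (adjmx_sqr R X) (adjmx_mulJ R X) -scalemxAr (adjmx_mulJ R X).
rewrite mulmxDl mulmxBl mul_scalar_mx -!scalemxAl (adjmx_mulJ R X).
rewrite constmx1_sqr.
by move/matrixP/(_ i0 i0); rewrite !mxE => h; lra.
Qed.

(** * The multiplicity of the negative eigenvalue *)

Section Eigenvalue.

Variable a : R.
Hypothesis a_gt0 : 0 < a.
Hypothesis a_root : a ^+ 2 + c%:R * a - (k%:R - c%:R) = 0.

Lemma degreeE : k%:R = a ^+ 2 + c%:R * (a + 1) :> R.
Proof. by rewrite -[LHS]addr0 -a_root; ring. Qed.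

Let B := a%:M - A.

Lemma shifted_adjmx_sqr : B *m B = (a *+ 2 + c%:R) *: B + c%:R *: J.
Proof.
rewrite mulmxBl !mulmxBr !mul_mx_scalar mul_scalar_mx.
rewrite (adjmx_sqr R X) degreeE.
apply/matrixP => i j; rewrite !mxE.
by case: (i == j); rewrite ?mulr1n ?mulr0n; ring.
Qed.

Lemma shifted_mulJ : B *m J = (a - k%:R) *: J.
Proof. by rewrite mulmxBl mul_scalar_mx (adjmx_mulJ R X) scalerBl. Qed.

Lemma J_mul_shifted : J *m B = (a - k%:R) *: J.
Proof. by rewrite mulmxBr mul_mx_scalar (J_mul_adjmx R X) scalerBl. Qed.

(** The integer m is the multiplicity of the eigenvalue -(a + c). The matrix B
    is corrected by a multiple of J so as to vanish on the constant vectors as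
    well; its square is then 2a + c times itself. *)
Lemma SRNT_multiplicity :
  exists m : nat, (a *+ 2 + c%:R) * m%:R = a * (n - 1) + k%:R.
Proof.
have n0 : n != 0 by rewrite pnatr_eq0 -lt0n SRNT_card_gt0.
pose s := a *+ 2 + c%:R.
have s0 : s != 0.
  by rewrite gt_eqF // ltr_wpDr ?ler0n ?pmulrn_lgt0.
(* B + t J kills the constant vectors, as (a - k) + t n = 0. *)
pose t := (k%:R - a) / n.
have tn : t * n = k%:R - a by rewrite divfK.
pose E := B + t *: J.
have EE : E *m E = s *: E.
  have -> : E *m E = B *m B + t *: (B *m J) + t *: (J *m B)
                     + (t * t) *: (J *m J).
    rewrite /E; move: B => B'; rewrite mulmxDl !mulmxDr -!scalemxAl.
    by rewrite -!scalemxAr scalerA !addrA.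
  rewrite shifted_adjmx_sqr shifted_mulJ J_mul_shifted constmx1_sqr -/s.
  rewrite /E; move: B => B'; rewrite scalerDr !scalerA -!addrA -!scalerDl.
  congr (_ + _ *: _).
  rewrite -[t * t * n]mulrA tn.
  apply: (mulIf n0); rewrite [LHS]mulrDl SRNT_order.
  transitivity (s * (t * n)); last by rewrite mulrA.
  transitivity (k%:R ^+ 2 - k%:R + c%:R + c%:R * k%:R + (t * n) * (a - k%:R)).
    by ring.
  by rewrite tn /s degreeE; ring.
exists (\rank (s^-1 *: E)).
rewrite -mxtrace_idempotent; last first.
  by rewrite -scalemxAl -scalemxAr EE (scalerA _ s) mulVf // scale1r.
rewrite mxtraceZ mulrA mulfV // mul1r /E /B !raddfD raddfN /= mxtrace_scalar.
rewrite mxtraceZ.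
have -> : \tr A = 0.
  by apply: big1 => i _; rewrite mxE (SRNT_irr X).
have -> : \tr J = n.
  rewrite /mxtrace (eq_bigr (fun=> 1)) ?sumr_const ?card_ord //.
  by move=> i _; rewrite mxE.
by rewrite tn -mulr_natr -/n; ring.
Qed.

(** * The Krein bound on c *)

Let adj (f : V -> R) (w : V) : R := \sum_z (e w z)%:R * f z.

(** For u of coordinate sum 0, (2a + c) (u^T B u) = u^T B^2 u is a sum of
    squares. *)
Lemma sum_shifted_adj_ge0 (f : V -> R) :
  \sum_z f z = 0 -> 0 <= \sum_w f w * (a * f w - adj f w).
Proof.
move=> f0.
have sumE (F : V -> R) : \sum_(i < #|V|) F (enum_val i) = \sum_x F x.
  by rewrite [RHS](reindex (@enum_val V V)) //; apply/onW_bij/enum_val_bij.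
pose u : 'cV[R]_#|V| := \col_i f (enum_val i).
have Bu i : (B *m u) i 0 = a * f (enum_val i) - adj f (enum_val i).
  rewrite mulmxBl mul_scalar_mx !mxE; congr (_ - _).
  by rewrite /adj -sumE; apply: eq_bigr => j _; rewrite !mxE.
have Ju : J *m u = 0.
  apply/matrixP => i j; rewrite !mxE -[RHS]f0 -sumE.
  by apply: eq_bigr => l _; rewrite !mxE mul1r.
have Btr : B^T = B by rewrite linearB /= tr_scalar_mx (adjmx_tr R X).
have : (B *m u)^T *m (B *m u) = (a *+ 2 + c%:R) *: (u^T *m (B *m u)).
  rewrite trmx_mul Btr -mulmxA (mulmxA B B) shifted_adjmx_sqr.
  by rewrite mulmxDl -!scalemxAl Ju scaler0 addr0 -scalemxAr.
move/matrixP/(_ 0 0); rewrite mxE [RHS]mxE.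
have -> : (u^T *m (B *m u)) 0 0 = \sum_w f w * (a * f w - adj f w).
  by rewrite mxE -sumE; apply: eq_bigr => i _; rewrite Bu !mxE.
move=> h.
have s0 : 0 < a *+ 2 + c%:R by rewrite ltr_wpDr ?ler0n ?pmulrn_lgt0.
rewrite -(pmulr_rge0 _ s0) -h; apply: sumr_ge0 => i _.
by rewrite [X in X * _]mxE -expr2 sqr_ge0.
Qed.

(** For non-adjacent x and y, the test function f below has the value
    a (a + 1) at y, -a at x, a at the common neighbours of x and y, -1 at the
    other neighbours of x, and 0 elsewhere. Its coordinate sum is 0, and
    adj f = a f holds at every point of its support but y. So only y
    contributes to the quadratic form, namely
    a (a + 1) (a^2 (a + 1) - a c). *)
Lemma SRNT_c_le : c%:R <= a * (a + 1).
Proof.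
have [x [y [nxy exy]]] := SRNT_nonadj_pair X.
have esym := SRNT_sym X; have eirr := SRNT_irr X.
pose f z : R := a * (a + 1) * (z == y)%:R - a * (z == x)%:R
                - (e x z)%:R + (a + 1) * (e x z && e y z)%:R.
(* adj f w is expressed by the numbers of common neighbours of w and x, and
   of w, x and y; these are determined by the parameters when w is in the
   support of f. *)
have sum_ind (P : pred V) : \sum_z (P z)%:R = #|P|%:R :> R.
  by rewrite -natr_sum -sum1_card [in RHS]big_mkcond.
have sum_at (F : V -> R) v : \sum_z F z * (z == v)%:R = F v.
  rewrite (bigD1 v) //= eqxx mulr1 big1 ?addr0 // => z /negPf->.
  by rewrite mulr0.
have adjf w : adj f w = a * (a + 1) * (e w y)%:R - a * (e w x)%:R
    - #|[pred z | e w z && e x z]|%:R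
    + (a + 1) * #|[pred z | [&& e w z, e x z & e y z]]|%:R.
  rewrite -(sum_at (fun z => (e w z)%:R) y) -(sum_at (fun z => (e w z)%:R) x).
  rewrite -!sum_ind !mulr_sumr -!sumrN -!big_split /=.
  apply: eq_bigr => z _; rewrite /f.
  by case: (e w z); case: (z == x); case: (z == y); case: (e x z);
     case: (e y z) => /=; ring.
have triangle w v : e w v -> #|[pred z | e w z && e v z]| = 0%N.
  by move=> /(SRNT_adj X) <-; apply: eq_card => z; rewrite !inE.
have triangle3 w v (P : pred V) :
    e w v -> #|[pred z | [&& e w z, e v z & P z]]| = 0%N.
  move=> /triangle h; apply/eqP; rewrite -leqn0 -h; apply/subset_leq_card.
  by apply/subsetP => z; rewrite !inE => /and3P[-> ->].
have common : #|[pred z | e x z && e y z]| = c.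
  by rewrite -(SRNT_nonadj X nxy exy); apply: eq_card => z; rewrite !inE.
have f0 : \sum_z f z = 0.
  transitivity (a * (a + 1) - a - k%:R + (a + 1) * c%:R); last first.
    by rewrite degreeE /=; ring.
  rewrite !big_split /= !sumrN.
  rewrite (sum_at (fun=> a * (a + 1))) (sum_at (fun=> a)) -mulr_sumr.
  rewrite !sum_ind common; congr (_ - _%:R + _).
  by rewrite -(SRNT_reg X x); apply: eq_card => z; rewrite !inE.
have := sum_shifted_adj_ge0 f0.
have nyx : (y == x) = false by rewrite eq_sym; apply: negbTE.
have adjfy : adj f y = a * c%:R.
  rewrite adjf eirr (esym y) (negPf exy).
  have -> : #|[pred z | e y z && e x z]| = c.
    by rewrite -[RHS]common; apply: eq_card => z; rewrite !inE andbC.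
  have -> : #|[pred z | [&& e y z, e x z & e y z]]| = c.
    rewrite -[RHS]common; apply: eq_card => z; rewrite !inE.
    by case: (e x z); case: (e y z).
  by rewrite /=; ring.
have adjfx : adj f x = - a ^+ 2.
  rewrite adjf eirr (negPf exy).
  have -> : #|[pred z | e x z && e x z]| = k.
    by rewrite -[RHS](SRNT_reg X x); apply: eq_card => z; rewrite !inE andbb.
  have -> : #|[pred z | [&& e x z, e x z & e y z]]| = c.
    rewrite -[RHS]common; apply: eq_card => z; rewrite !inE.
    by case: (e x z); case: (e y z).
  by rewrite degreeE /=; ring.
rewrite (bigD1 y) //= big1 => [|w wy]; last first.
  rewrite {1}/f (negPf wy).
  have [->|wx] := eqVneq w x.
    by rewrite adjfx /f eqxx (negPf nxy) eirr /=; ring.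
  case exw : (e x w); last by rewrite /=; ring.
  have ewx : e w x by rewrite esym.
  rewrite adjf ewx (triangle _ _ ewx) triangle3 //.
  rewrite /f (negPf wy) (negPf wx) exw (esym w y).
  by case: (e y w) => /=; ring.
rewrite adjfy /f eqxx nyx (negPf exy) /= => h.
have a2 : 0 < a ^+ 2 * (a + 1) by rewrite mulr_gt0 ?exprn_gt0 // ltr_wpDr.
rewrite -subr_ge0 -(pmulr_rge0 _ a2).
by apply: le_trans h _; rewrite le_eqVlt; apply/orP; left; apply/eqP; ring.
Qed.

End Eigenvalue.

End Spectrum.

Unset Implicit Arguments.

(** * Bounds and divisibility conditions *)

Theorem mainTheorem5 (R : realType) (V : finType) (e : rel V) (k c q : nat)
    (hq : (0 < q)%N) (X : SRNT e k c)
    (hlambda1 : SRNT_lambda1 e k c (q%:R : R)) :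
  [/\ Num.ceil (2 * q%:R ^+ 3 + 3 * q%:R ^+ 2 - q%:R
                + 2 * q%:R * (q%:R + 1) * Num.sqrt (q%:R ^+ 2 + q%:R - 2) : R)
        <= #|V|%:Z,
      (#|V| <= q ^ 2 * (q + 3) ^ 2)%N,
      (1 <= c <= q * (q + 1))%N,
      (c %| q ^ 4 - q ^ 2)%N
    & (c + 2 * q %| q ^ 4 + 3 * q ^ 3 + 5 * q ^ 2 + 3 * q
                    + (q * (q ^ 4 - q ^ 2)) %/ c)%N].
Proof.
have [_ root q_gt0] := hlambda1.
have c_gt0 := SRNT_c_ge1 X.
have c_le : (c <= q * (q + 1))%N.
  by have := SRNT_c_le X q_gt0 root; rewrite natr1 -natrM ler_nat addn1.
have kE : k = (q ^ 2 + c * (q + 1))%N.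
  apply/eqP; rewrite -(eqr_nat R) natrD natrX natrM natrD.
  by rewrite (degreeE root).
have q4 : (q ^ 2 <= q ^ 4)%N by rewrite leq_pexp2l.
(* The term q is moved to the left to stay in the natural numbers. *)
have orderE : (c * (#|V| + q) =
    c * (2 * q ^ 3 + 3 * q ^ 2 + c * (q + 1) * (q + 2)) + (q ^ 4 - q ^ 2))%N.
  apply/eqP; rewrite -(eqr_nat R) !(natrD, natrM, natrX, natrB) //.
  have := SRNT_order R X; rewrite kE !(natrD, natrM, natrX) => h.
  by apply/eqP; rewrite mulrDr h; ring.
have c_dvd : (c %| q ^ 4 - q ^ 2)%N.
  set s := (2 * q ^ 3 + _ + _)%N in orderE.
  by rewrite -(dvdn_addr _ (dvdn_mulr s (dvdnn c))) -orderE dvdn_mulr.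
have /dvdnP[r rE] := c_dvd.
have orderE' : (#|V| + q =
    2 * q ^ 3 + 3 * q ^ 2 + c * (q + 1) * (q + 2) + r)%N.
  apply/eqP; rewrite -(eqn_pmul2l c_gt0) orderE rE [(r * c)%N]mulnC.
  by rewrite -mulnDr.
have rcE : r%:R * c%:R = q%:R ^+ 4 - q%:R ^+ 2 :> R.
  by rewrite -natrM -rE natrB // !natrX.
have nE : #|V|%:R = 2 * q%:R ^+ 3 + 3 * q%:R ^+ 2 - q%:R
    + (c%:R * (q%:R + 1) * (q%:R + 2) + r%:R) :> R.
  apply: (addIr q%:R); rewrite -[LHS]natrD orderE' !(natrD, natrM, natrX).
  by ring.
split=> //; last 1 first.
- have [m mE] := SRNT_multiplicity X q_gt0 root.
  have {}mE : ((c + 2 * q) * m + q = q * #|V| + k)%N.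
    apply/eqP; rewrite -(eqr_nat R) !(natrD, natrM).
    apply/eqP; transitivity ((q%:R *+ 2 + c%:R) * m%:R + q%:R : R).
      by ring.
    by rewrite mE; ring.
  have -> : ((q * (q ^ 4 - q ^ 2)) %/ c = q * r)%N.
    by rewrite rE mulnA mulnK.
  (* Adding (c + 2q) m avoids a truncated subtraction. *)
  rewrite -(@dvdn_addl ((c + 2 * q) * m)) ?dvdn_mulr //.
  suff -> : (q ^ 4 + 3 * q ^ 3 + 5 * q ^ 2 + 3 * q + q * r + (c + 2 * q) * m
    = (c + 2 * q) * ((q + 1) ^ 3 + r))%N by rewrite dvdn_mulr.
  apply/eqP; rewrite -(eqr_nat R) !(natrD, natrM, natrX); apply/eqP.
  have := congr1 (fun j => j%:R : R) mE; rewrite kE.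
  rewrite !(natrD, natrM, natrX) nE => mE'.
  apply: (addIr (q%:R : R)); rewrite -[LHS]addrA mE'.
  apply: (addIr (r%:R * c%:R)); rewrite [in RHS]rcE.
  by ring.
- rewrite real_ceil_le_int ?num_real // -[X in _ <= X]pmulrn nE lerD2l.
  set w := q%:R ^+ 2 + q%:R - 2.
  have w_ge0 : 0 <= w.
    have q1 : 1 <= q%:R :> R by rewrite ler1n.
    by rewrite /w; nra.
  pose x : R := c%:R * (q%:R + 1) * (q%:R + 2).
  rewrite -/x.
  have x_ge0 : 0 <= x
    by rewrite /x -(natrD _ q 1) -(natrD _ q 2) -!natrM.
  have xr : x * r%:R = (q%:R * (q%:R + 1)) ^+ 2 * w.
    transitivity (r%:R * c%:R * ((q%:R + 1) * (q%:R + 2)) : R).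
      by rewrite /x; ring.
    by rewrite rcE /w; ring.
  have B_ge0 : 0 <= 2 * q%:R * (q%:R + 1) :> R by rewrite !mulr_ge0 ?addr_ge0.
  rewrite -ler_sqr ?nnegrE ?(addr_ge0 x_ge0) ?(mulr_ge0 B_ge0) ?sqrtr_ge0 //.
  rewrite exprMn sqr_sqrtr //.
  (* Arithmetic and geometric means: (x + r)^2 - 4xr = (x - r)^2. *)
  have -> : (2 * q%:R * (q%:R + 1)) ^+ 2 * w = 4 * (x * r%:R).
    by rewrite xr; ring.
  by rewrite -subr_ge0; have := sqr_ge0 (x - r%:R); congr (0 <= _); ring.
- have [d dE] : exists d, (q * (q + 1) = c + d)%N.
    by exists (q * (q + 1) - c)%N; rewrite subnKC.
  rewrite -(leq_pmul2l c_gt0) -(leq_add2r (c * q)) -mulnDr orderE'.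
  suff -> : (c * (q ^ 2 * (q + 3) ^ 2) + c * q =
      c * (2 * q ^ 3 + 3 * q ^ 2 + c * (q + 1) * (q + 2) + r)
      + d * ((q + 1) * (q + 2) * c - q * (q - 1)))%N by exact: leq_addr.
  have le1 : (q * (q - 1) <= (q + 1) * (q + 2) * c)%N.
    by rewrite (leq_trans _ (leq_pmulr _ c_gt0)) // leq_mul //; lia.
  have dR : d%:R = q%:R * (q%:R + 1) - c%:R :> R.
    by rewrite natr1 -natrM -addn1 dE natrD addrC addKr.
  apply/eqP; rewrite -(eqr_nat R) !(natrD, natrM, natrX, natrB) // dR.
  rewrite [X in _ == X + _]mulrDr [X in _ == _ + X + _]mulrC rcE.
  by apply/eqP; ring.
- by rewrite c_gt0.
Qed.
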